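(* Let $k$ be a field and $n\geq1$. Let $U=\{g(t_1)\cdots g(t_n): g(x)\in k[x],\ g(0)\neq0\}$, a multiplicatively closed subset of $k[s_1(t),\dots,s_n(t)]$, and $H_n=U^{-1}k[s_1(t),\dots,s_n(t)]$. For a $k$-algebra homomorphism $\psi\colon H_n\to A$, write $F_n^\psi(x)=x^n-\psi(s_1(t))x^{n-1}+\cdots+(-1)^n\psi(s_n(t))\in A[x]$. Then for every $k$-algebra $A$, the ideal $(F_n^\psi(x))$ of $A\otimes_k k[x]_{(x)}$ lies in $\mathcal{H}ilb_a^n(A)$, and the map $$\mathcal F(A)\colon \operatorname{Hom}_{k\text{-alg}}(H_n,A)\to\mathcal{H}ilb_a^n(A),\qquad \psi\mapsto (F_n^\psi(x)),$$ is a bijection; these maps form an isomorphism of functors from $k$-algebras to sets. Equivalently, $H_n$ represents the functor $\mathcal{H}ilb_a^n$.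
   Context: $k[t_1,\dots,t_n]$ is a polynomial ring over the field $k$, and $s_i(t)$ is the $i$-th elementary symmetric polynomial in $t_1,\dots,t_n$. $k[x]_{(x)}$ is the localization of $k[x]$ at the multiplicative set of polynomials $g(x)$ with $g(0)\neq0$, and $A[x]=A\otimes_k k[x]$. The affine Hilbert functor $\mathcal{H}ilb_a^n$ from $k$-algebras to sets sends a $k$-algebra $A$ to the set of ideals $I$ of $A\otimes_k k[x]_{(x)}$ such that $A\otimes_k k[x]_{(x)}/I$ is a free $A$-module of rank $n$ (and acts on morphisms $A\to B$ by extension of ideals). *)

(* Defs.v *)
From HB Require Import structures.
From mathcomp Require Import all_boot all_order all_algebra.
From mathcomp Require Import mpoly.
Set Implicit Arguments. Unset Strict Implicit. Unset Printing Implicit Defensive.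
Import Order.TTheory GRing.Theory.
Local Open Scope ring_scope.

(* k[t_1..t_n] = {mpoly k[n]} is a domain, so H_n is realised as a subring
   of its fraction field. *)

Definition Frac_t (k : fieldType) (n : nat) := {fraction {mpoly k[n]}}.

Definition tofr (k : fieldType) (n : nat) (p : {mpoly k[n]}) : Frac_t k n :=
  FracField.tofrac p.

Definition esym_tuple (k : fieldType) (n : nat) : n.-tuple {mpoly k[n]} :=
  [tuple mesym n k i.+1 | i < n].

Definition in_ks (k : fieldType) (n : nat) (p : {mpoly k[n]}) : Prop :=
  exists q : {mpoly k[n]}, p = q \mPo (esym_tuple k n).

Definition Uprod (k : fieldType) (n : nat) (g : {poly k}) : {mpoly k[n]} :=
  \prod_(i < n) (map_poly (@mpolyC n k) g).['X_i].

Definition in_U (k : fieldType) (n : nat) (u : {mpoly k[n]}) : Prop :=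
  exists g : {poly k}, g.[0] != 0 /\ u = Uprod n g.

Definition Hn (k : fieldType) (n : nat) (x : Frac_t k n) : Prop :=
  exists p u, in_ks p /\ in_U u /\ x = tofr p / tofr u.

(* psi (defined on the fraction field, only its values on H_n matter) is a
   k-algebra homomorphism H_n -> A *)
Definition is_Hn_hom (k : fieldType) (n : nat) (A : comAlgType k)
    (psi : Frac_t k n -> A) : Prop :=
  [/\ psi 1 = 1,
      (forall x y, Hn x -> Hn y -> psi (x + y) = psi x + psi y),
      (forall x y, Hn x -> Hn y -> psi (x * y) = psi x * psi y) &
      (forall (c : k) x, Hn x -> psi (tofr (c%:MP) * x) = c *: psi x)].

Definition Fpoly (k : fieldType) (n : nat) (A : comAlgType k)
    (psi : Frac_t k n -> A) : {poly A} :=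
  \sum_(i < n.+1) ((-1) ^+ i * psi (tofr (mesym n k i))) *: 'X^(n - i).

(* ---------- A (x) k[x]_(x), as a localization of A[x] ---------- *)

Definition Sx (k : fieldType) (A : comAlgType k) (s : {poly A}) : Prop :=
  exists g : {poly k}, g.[0] != 0 /\ s = map_poly (in_alg A) g.

Definition is_localization (R : comPzRingType) (L : comPzRingType)
    (S : R -> Prop) (j : {rmorphism R -> L}) : Prop :=
  [/\ (forall s, S s -> exists v, j s * v = 1),
      (forall l, exists r s, S s /\ l * j s = j r) &
      (forall r, j r = 0 -> exists s, S s /\ s * r = 0)].

Definition is_ideal (L : comPzRingType) (I : L -> Prop) : Prop :=
  [/\ I 0, (forall x y, I x -> I y -> I (x + y)) &
      (forall l x, I x -> I (l * x))].

Definition pideal (L : comPzRingType) (f : L) : L -> Prop :=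
  fun y => exists l, y = l * f.

(* L / I is a free A-module of rank n (A acting on L through j o polyC):
   there are e_1..e_n in L whose classes form an A-basis of L/I *)
Definition quot_free_rank (k : fieldType) (A : comAlgType k) (L : comPzRingType)
    (j : {rmorphism {poly A} -> L}) (n : nat) (I : L -> Prop) : Prop :=
  exists e : 'I_n -> L, forall l : L,
    exists! a : {ffun 'I_n -> A}, I (l - \sum_(i < n) j ((a i)%:P) * e i).

(* I is in Hilb_a^n(A), where L = A (x) k[x]_(x) via j *)
Definition in_Hilb (k : fieldType) (A : comAlgType k) (L : comPzRingType)
    (j : {rmorphism {poly A} -> L}) (n : nat) (I : L -> Prop) : Prop :=
  is_ideal I /\ quot_free_rank j n I.

Definition ext_ideal (L1 L2 : comPzRingType) (Phi : L1 -> L2) (I : L1 -> Prop)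
  : L2 -> Prop :=
  fun y => exists m (l : 'I_m -> L2) (x : 'I_m -> L1),
    (forall i, I (x i)) /\ y = \sum_(i < m) l i * Phi (x i).

(* Main.v *)
Require Import Defs.
From HB Require Import structures.
From mathcomp Require Import all_boot all_order all_algebra.
From mathcomp Require Import mpoly ring.
From Stdlib Require Import ClassicalEpsilon.
From Stdlib Require Import FunctionalExtensionality PropExtensionality.
Import GRing.Theory.
Import Pdiv.Ring Pdiv.RingMonic.
Local Open Scope ring_scope.
Set Implicit Arguments. Unset Strict Implicit. Unset Printing Implicit Defensive.

(** For a monic [F] of degree [n] over [A], let [N_F p] be the determinant of
    multiplication by [p] on [A[x]/F] in the basis [1, x, .., x^(n-1)]. It is
    multiplicative, compatible with base change, and [p] is invertible modulo
    [F] iff [N_F p] is a unit. When [F] is the product of the [x - t_i], the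
    Vandermonde matrix diagonalises multiplication by [p], so [N_F g] is the
    product of the [g(t_i)]; by base change from the universal case,
    [psi (g(t_1) .. g(t_n)) = N_F g] for [F] attached to [psi]. Hence [psi]
    extends from [k[s_1, .., s_n]] to [H_n] iff every [g] with [g(0) <> 0] is
    invertible modulo [F], which in turn makes [1, x, .., x^(n-1)] a basis of
    [L/(F)].

    Conversely, if [L/I] is free of rank [n], let [F] be the characteristic
    polynomial of multiplication by [x]. By Cayley-Hamilton [F] lies in [I] and
    the inverse of each [g] in [L/I] is a polynomial in [g], so the [n] powers
    [1, x, .., x^(n-1)] generate [L/I]; being as many as the rank they form a
    basis, and therefore [I = (F)]. *)

(** * Multiplication modulo a monic polynomial, and its norm *)

Section MulMod.
Variables (R : comNzRingType) (n : nat) (F : {poly R}).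
Hypotheses (monF : F \is monic) (sizeF : size F = n.+1).

Definition mulmod_mx (p : {poly R}) : 'M[R]_n :=
  \matrix_(i < n) poly_rV (rmodp (p * 'X^i) F).

Lemma size_rmodp_monic p : (size (rmodp p F) <= n)%N.
Proof. by rewrite -ltnS -sizeF ltn_rmodp monic_neq0. Qed.

Lemma poly_rV_rmodpK p : rVpoly (poly_rV (rmodp p F) : 'rV_n) = rmodp p F.
Proof. exact/poly_rV_K/size_rmodp_monic. Qed.

Lemma size_rVpoly (v : 'rV[R]_n) : (size (rVpoly v) <= n)%N.
Proof. exact: size_poly. Qed.

Lemma rVpolyE (v : 'rV[R]_n) : rVpoly v = \sum_(i < n) v 0 i *: 'X^i.
Proof.
by rewrite {1}(row_sum_delta v) linear_sum; apply: eq_bigr => i _;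
   rewrite linearZ /= rVpoly_delta.
Qed.

Lemma rmodp_small_monic (p : {poly R}) : (size p <= n)%N -> rmodp p F = p.
Proof. by move=> sp; rewrite rmodp_small // sizeF. Qed.

Lemma rVpoly_mulmod (v : 'rV_n) p :
  rVpoly (v *m mulmod_mx p) = rmodp (rVpoly v * p) F.
Proof.
rewrite mulmx_sum_row linear_sum rVpolyE mulr_suml (rmodp_sum monF).
apply: eq_bigr => i _; rewrite linearZ /= rowK poly_rV_rmodpK.
by rewrite -(rmodpZ monF) -scalerAl [p * _]mulrC.
Qed.

Lemma mulmod_mxM p q : mulmod_mx (p * q) = mulmod_mx p *m mulmod_mx q.
Proof.
apply/row_matrixP => i; rewrite row_mul; apply: (can_inj rVpolyK).
rewrite rVpoly_mulmod !rowK !poly_rV_rmodpK (rmodp_mulml monF).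
by rewrite mulrAC.
Qed.

Lemma mulmod_mx_modl p q : mulmod_mx (p + q * F) = mulmod_mx p.
Proof.
apply/row_matrixP => i; rewrite !rowK mulrDl (rmodpD monF) mulrAC.
by rewrite (rmodp_mull monF) addr0.
Qed.

Lemma mulmod_mx1 : mulmod_mx 1 = 1%:M.
Proof.
apply/row_matrixP => i; rewrite rowK mul1r rmodp_small_monic ?size_polyXn //.
by rewrite -rVpoly_delta rVpolyK row1.
Qed.

Definition mod_norm p := \det (mulmod_mx p).

Lemma mod_norm_unitl p h q : h * p = 1 + q * F -> mod_norm h * mod_norm p = 1.
Proof.
by move=> e; rewrite /mod_norm -det_mulmx -mulmod_mxM e mulmod_mx_modl
   mulmod_mx1 det1.
Qed.

(** Cramer's rule: [c] times the adjugate inverts the matrix, and applying it to the vector of [1]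
    gives the inverse of [p]. Positivity of [n] makes [1] a vector of the basis. *)
Lemma mod_norm_invertible p c : (0 < n)%N -> c * mod_norm p = 1 ->
  exists h q, h * p = 1 + q * F.
Proof.
move=> n0 cN; pose v : 'rV_n := poly_rV 1 *m (c *: \adj (mulmod_mx p)).
have vM : v *m mulmod_mx p = poly_rV 1.
  rewrite -mulmxA -scalemxAl mul_adj_mx scale_scalar_mx cN.
  by rewrite mulmx1.
have := rVpoly_mulmod v p; rewrite vM poly_rV_K ?size_poly1 // => e.
exists (rVpoly v), (rdivp (rVpoly v * p) F).
by rewrite {1}(rdivp_eq monF (rVpoly v * p)) -e addrC.
Qed.

End MulMod.

(** The image of a division by a monic polynomial is again such a division, and remainders are
    unique. *)
Lemma map_rmodp_monic (R S : comNzRingType) (f : {rmorphism R -> S}) n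
    (F p : {poly R}) : F \is monic -> size F = n.+1 ->
  map_poly f (rmodp p F) = rmodp (map_poly f p) (map_poly f F).
Proof.
move=> monF sF; have monfF : map_poly f F \is monic by rewrite monic_map.
rewrite [in RHS](rdivp_eq monF p) rmorphD rmorphM /=.
rewrite rmodp_addl_mul_small // (size_map_poly_id0 (p := F)).
  by rewrite sF (leq_ltn_trans (size_poly _ _)) // ltnS size_rmodp_monic.
by rewrite (monicP monF) rmorph1 oner_neq0.
Qed.

Lemma map_mod_norm (R S : comNzRingType) (f : {rmorphism R -> S}) n
    (F p : {poly R}) : F \is monic -> size F = n.+1 ->
  f (mod_norm n F p) = mod_norm n (map_poly f F) (map_poly f p).
Proof.
move=> monF sF; rewrite /mod_norm -det_map_mx; congr (\det _).
apply/matrixP => i l; rewrite !mxE -coef_map (map_rmodp_monic _ _ monF sF) //.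
by rewrite rmorphM /= map_polyXn.
Qed.

(* Evaluation at the roots conjugates multiplication by [p] to a diagonal
   matrix; the conjugating matrix is the Vandermonde matrix. *)
Lemma mod_norm_prod (R : idomainType) n (t : 'I_n -> R) (p : {poly R}) :
  injective t ->
  mod_norm n (\prod_(i < n) ('X - (t i)%:P)) p = \prod_(i < n) p.[t i].
Proof.
move=> t_inj; set F := \prod_(i < n) _.
have monF : F \is monic by apply: monic_prod_XsubC.
have sF : size F = n.+1.
  by rewrite size_prod_XsubC /index_enum -enumT -cardT card_ord.
have rootF i : F.[t i] = 0.
  by rewrite horner_prod (bigD1 i) //= hornerXsubC subrr mul0r.
pose V := Vandermonde n (\row_i t i).
have VD : mulmod_mx n F p *m V = V *m diag_mx (\row_i p.[t i]).
  apply/matrixP => i l; rewrite mul_mx_diag !mxE.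
  transitivity (rmodp (p * 'X^i) F).[t l].
    rewrite (horner_coef_wide _ (size_rmodp_monic monF sF _)).
    by apply: eq_bigr => m _; rewrite !mxE.
  have := congr1 (fun q => q.[t l]) (rdivp_eq monF (p * 'X^i)).
  rewrite hornerD !hornerM rootF mulr0 add0r hornerXn => <-.
  by rewrite mulrC.
have V0 : \det V != 0.
  rewrite det_Vandermonde prodf_seq_neq0; apply/allP => i _ /=.
  rewrite prodf_seq_neq0; apply/allP => l _; apply/implyP => lt_il.
  by rewrite !mxE subr_eq0 (inj_eq t_inj) -val_eqE /= gtn_eqF.
apply: (mulIf V0); rewrite -det_mulmx VD det_mulmx det_diag mulrC.
by congr (_ * _); apply: eq_bigr => i _; rewrite mxE.
Qed.

(** * Polynomials written with alternating signs, as in Viete's formula *)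

Section AlternatingPoly.
Variables (R : comNzRingType) (n : nat).

Definition alt_poly (a : nat -> R) : {poly R} :=
  \sum_(i < n.+1) ((-1) ^+ i * a i) *: 'X^(n - i).

Lemma coef_alt_poly a i : (i <= n)%N -> (alt_poly a)`_(n - i) = (-1) ^+ i * a i.
Proof.
move=> le_in; rewrite coef_sum (bigD1 (Ordinal (le_in : i < n.+1)%N)) //=.
rewrite coefZ coefXn eqxx mulr1 big1 ?addr0 // => l ne_li.
rewrite coefZ coefXn (eqn_sub2lE le_in (ltn_ord l)) eq_sym.
rewrite -[_ == _ :> nat]/(l == Ordinal (le_in : i < n.+1)%N) (negPf ne_li).
by rewrite mulr0.
Qed.

Lemma size_alt_poly_leq a : (size (alt_poly a) <= n.+1)%N.
Proof.
apply: leq_trans (size_sum _ _ _) _; apply/bigmax_leqP => i _.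
apply: leq_trans (size_scale_leq _ _) _.
by rewrite size_polyXn ltnS leq_subr.
Qed.

Lemma size_alt_poly a : a 0%N = 1 -> size (alt_poly a) = n.+1.
Proof.
move=> a0; apply/eqP; rewrite eqn_leq size_alt_poly_leq /=.
rewrite ltnNge; apply/negP => /leq_sizeP/(_ n (leqnn n)).
have := coef_alt_poly a (leq0n n).
by rewrite subn0 => -> /eqP; rewrite a0 mulr1 oner_eq0.
Qed.

Lemma monic_alt_poly a : a 0%N = 1 -> alt_poly a \is monic.
Proof.
move=> a0; rewrite monicE lead_coefE size_alt_poly //= -[X in _`_X](subn0 n).
by rewrite coef_alt_poly // a0 mulr1.
Qed.

Lemma eq_alt_poly a b : (forall i, (i <= n)%N -> a i = b i) ->
  alt_poly a = alt_poly b.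
Proof. by move=> ab; apply: eq_bigr => i _; rewrite ab // -ltnS. Qed.

Lemma alt_poly_inj a b : alt_poly a = alt_poly b ->
  forall i, (i <= n)%N -> a i = b i.
Proof.
move=> ab i le_in; have := coef_alt_poly a le_in.
by rewrite ab coef_alt_poly // => /(can_inj (@signrMK _ i)).
Qed.

Lemma alt_poly_coefs (F : {poly R}) : (size F <= n.+1)%N ->
  alt_poly (fun i => (-1) ^+ i * F`_(n - i)) = F.
Proof.
move=> sF; apply/polyP => m; have [le_mn|lt_nm] := leqP m n.
  rewrite -{1}(subKn le_mn) coef_alt_poly ?leq_subr //.
  by rewrite signrMK subKn.
by rewrite !nth_default // (leq_trans _ lt_nm) // size_alt_poly_leq.
Qed.

End AlternatingPoly.

Lemma map_alt_poly (R S : comNzRingType) (f : {rmorphism R -> S}) n a :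
  map_poly f (alt_poly n a) = alt_poly n (f \o a).
Proof.
rewrite rmorph_sum; apply: eq_bigr => i _ /=.
by rewrite map_polyZ map_polyXn rmorphM rmorph_sign.
Qed.

(** * The universal monic polynomial and its norm *)

Section Universal.
Variables (k : fieldType) (n : nat).

Lemma prod_XsubX_alt_poly :
  \prod_(i < n) ('X - ('X_i)%:P) = alt_poly n (mesym n k).
Proof.
(* [Viete] is an identity over the integers; [f] carries it to [k]. *)
pose f : {rmorphism {mpoly int[n]} -> {mpoly k[n]}} :=
  mmap intr (fun i => 'X_i).
have := congr1 (map_poly f) (Viete n); rewrite !rmorph_prod rmorph_sum /=.
under eq_bigr do rewrite rmorphB /= map_polyX map_polyC /= mmapX mmap1U.
move=> ->; apply: eq_bigr => i _; rewrite !map_polyZ map_polyXn scalerA /=.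
rewrite rmorph_sign; congr (_ * _ *: _).
rewrite /mesym rmorph_sum; apply: eq_bigr => h _ /=.
by rewrite rmorph_prod; apply: eq_bigr => l _; rewrite /= mmapX mmap1U.
Qed.

(* The variable ['X_i] stands for the elementary symmetric polynomial of
   degree [i.+1], and the entry of index [0] is [1]. *)
Definition gen_esym (i : nat) : {mpoly k[n]} :=
  if i is i'.+1 then oapp (fun l : 'I_n => 'X_l) 0 (insub i') else 1.

Lemma gen_esymS (i : 'I_n) : gen_esym i.+1 = 'X_i.
Proof. by rewrite /= valK. Qed.

Lemma comp_gen_esym i : (i <= n)%N ->
  gen_esym i \mPo esym_tuple k n = mesym n k i.
Proof.
case: i => [|i lt_in]; first by rewrite comp_mpoly1 mesym0E.
by rewrite (gen_esymS (Ordinal lt_in)) comp_mpolyXU -tnth_nth tnth_mktuple.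
Qed.

(** The universal monic polynomial of degree [n]: its lower coefficients are, up to sign,
    independent variables, so every monic polynomial of degree [n] is a specialisation of it. *)
Definition gen_poly := alt_poly n gen_esym.

Lemma monic_gen_poly : gen_poly \is monic. Proof. exact: monic_alt_poly. Qed.
Lemma size_gen_poly : size gen_poly = n.+1. Proof. exact: size_alt_poly. Qed.

Lemma mpolyX_inj : injective (fun i : 'I_n => 'X_i : {mpoly k[n]}).
Proof.
move=> i l /(congr1 (mcoeff U_(i)%MM)); rewrite !mcoeffX eqxx.
case: eqP => [e _|_ /eqP]; last by rewrite oner_eq0.
by have := congr1 (fun m : 'X_{1..n} => m i) e; rewrite /= !mnm1E eqxx;
   case: eqP.
Qed.

End Universal.

(* Locked, as unification otherwise unfolds the determinant. *)
HB.lock Definition gen_norm (k : fieldType) (n : nat) (g : {poly k}) :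
    {mpoly k[n]} :=
  mod_norm n (gen_poly k n) (map_poly (@mpolyC n k) g).

(** Substituting the elementary symmetric polynomials turns [gen_poly] into the product of the
    ['X - t_i], where the norm is known. So [gen_norm n g] is the expression of [Uprod n g] as a
    polynomial in the [s_i]. *)
Lemma comp_gen_norm (k : fieldType) n (g : {poly k}) :
  gen_norm n g \mPo esym_tuple k n = Uprod n g.
Proof.
rewrite gen_norm.unlock (map_mod_norm _ _ (monic_gen_poly k n) (size_gen_poly k n)).
rewrite map_alt_poly.
rewrite (@eq_alt_poly _ _ _ (mesym n k)); last exact: comp_gen_esym.
rewrite -prod_XsubX_alt_poly mod_norm_prod; last exact: mpolyX_inj.
apply: eq_bigr => i _; congr _.[_]; rewrite -map_poly_comp.
by apply: eq_map_poly => c /=; rewrite comp_mpolyC.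
Qed.

(** * Quotients of the localization by a monic polynomial *)

Lemma pideal_is_ideal (L : comPzRingType) (f : L) : is_ideal (pideal f).
Proof.
split=> [|x y [a ->] [b ->]|l x [a ->]]; first by exists 0; rewrite mul0r.
  by exists (a + b); rewrite mulrDl.
by exists (l * a); rewrite mulrA.
Qed.

Definition Sx_invertible_mod (k : fieldType) (A : comAlgType k) (F : {poly A}) :=
  forall g : {poly k}, g.[0] != 0 ->
    exists h q, h * map_poly (in_alg A) g = 1 + q * F.

Section Localization.
Variables (k : fieldType) (n : nat) (A : comAlgType k) (L : comPzRingType).
Variables (j : {rmorphism {poly A} -> L}) (F : {poly A}).
Hypotheses (locj : is_localization (@Sx k A) j).
Hypotheses (monF : F \is monic) (sizeF : size F = n.+1).
Hypothesis invF : Sx_invertible_mod F.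

Lemma sum_rVpoly (a : {ffun 'I_n -> A}) :
  \sum_(i < n) j (a i)%:P * j 'X^i = j (rVpoly (\row_i a i)).
Proof.
rewrite rVpolyE rmorph_sum; apply: eq_bigr => i _.
by rewrite mxE -rmorphM mul_polyC.
Qed.

(** Injectivity of [A[x]/F -> L/(F)]: one denominator clears [l], a second one kills the kernel of
    [j], so a product of two denominators times [r] is a multiple of [F]. Both are invertible modulo
    [F], hence [F] divides [r], whose size is too small. *)
Lemma pideal_small_eq0 (r : {poly A}) : (size r <= n)%N ->
  pideal (j F) (j r) -> r = 0.
Proof.
move=> sr [l lr]; have [_ loc2 loc3] := locj.
have [w [s [[g [g0 ->]] lw]]] := loc2 l.
set sg := map_poly _ g in lw.
have : j (sg * r - w * F) = 0.
  by rewrite rmorphB !rmorphM lr /= -lw mulrCA mulrA subrr.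
case/loc3=> s' [[g' [g'0 ->]]]; set sg' := map_poly _ g'.
rewrite mulrBr => /subr0_eq e.
have [h [q hq]] := invF g0; have [h' [q' hq']] := invF g'0.
have: rmodp ((h' * sg') * (h * sg) * r) F = 0.
  have -> : h' * sg' * (h * sg) * r = h' * h * sg' * w * F.
    by rewrite -[RHS]mulrA -[RHS]mulrA -e; ring.
  exact: rmodp_mull.
rewrite hq hq'.
have -> : (1 + q' * F) * (1 + q * F) * r
        = r + (q' + q + q' * F * q) * r * F by ring.
by rewrite rmodpD // rmodp_mull // addr0 (rmodp_small_monic sizeF).
Qed.

Lemma in_Hilb_pideal : in_Hilb j n (pideal (j F)).
Proof.
split; first exact: pideal_is_ideal.
have [I0 ID IM] := pideal_is_ideal (j F).
exists (fun i => j 'X^i) => l.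
have [_ loc2 _] := locj; have [r [s [[g [g0 ->]] lr]]] := loc2 l.
have [h [q hq]] := invF g0.
set rho := rmodp (r * h) F.
have [w lw] : pideal (j F) (l - j rho).
  (* Modulo [F] the fraction [l], equal to [r / g], is [r * h], which is then reduced to [rho]; the
     witness collects the multiples of [F] from both replacements. *)
  exists (j (rdivp (r * h) F) - l * j q).
  have lqF : l * j (q * F) = j (r * h) - l.
    have -> : q * F = h * map_poly (in_alg A) g - 1 by rewrite hq addrC addKr.
    by rewrite rmorphB rmorph1 !rmorphM -lr; ring.
  have jrh : j (rdivp (r * h) F * F) = j (r * h) - j rho.
    by rewrite {2}(rdivp_eq monF (r * h)) rmorphD addrK.
  by rewrite mulrBl -rmorphM -mulrA -rmorphM lqF jrh; ring.
have rho_row : rho = rVpoly (\row_(i < n) [ffun i : 'I_n => rho`_i] i).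
  rewrite -[LHS](poly_rV_rmodpK monF sizeF); congr rVpoly.
  by apply/rowP => i; rewrite !mxE ffunE.
exists [ffun i : 'I_n => rho`_i]; split.
  by rewrite sum_rVpoly -rho_row lw; exists w.
move=> a; rewrite sum_rVpoly => Ia; apply/ffunP => i; rewrite ffunE.
suff -> : rho = rVpoly (\row_i a i) by rewrite coef_rVpoly_ord mxE.
apply/eqP; rewrite -subr_eq0; apply/eqP/pideal_small_eq0.
  apply: leq_trans (size_polyD _ _) _; rewrite size_polyN geq_max size_rVpoly.
  by rewrite size_rmodp_monic.
have -> : j (rho - rVpoly (\row_i a i))
        = (l - j (rVpoly (\row_i a i))) + (- w) * j F.
  by rewrite mulNr -lw rmorphB; ring.
by apply: ID => //; exists (- w).
Qed.

End Localization.

(** * The ring [H_n] and the homomorphisms out of it *)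

Section HnRing.
Variables (k : fieldType) (n : nat).
Implicit Types (p q : {mpoly k[n]}) (g : {poly k}).

Local Notation esymp q := (q \mPo esym_tuple k n).

Lemma Uprod1 : Uprod n (1 : {poly k}) = 1.
Proof. by rewrite /Uprod big1 // => i _; rewrite rmorph1 hornerC. Qed.

Lemma UprodM g g' : Uprod n (g * g') = Uprod n g * Uprod n g'.
Proof.
by rewrite /Uprod -big_split; apply: eq_bigr => i _; rewrite rmorphM hornerM.
Qed.

Lemma Uprod_neq0 g : g.[0] != 0 -> Uprod n g != 0.
Proof.
move=> g0; apply/prodf_neq0 => i _; apply: contraNneq g0.
(* Setting all [t_i] to [0] turns each factor [g(t_i)] into [g(0)]. *)
move/(congr1 (meval (fun=> 0 : k))); rewrite -horner_map /= mevalXU meval0.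
rewrite -map_poly_comp (eq_map_poly (g := id)) ?map_poly_id // => [->//|c] /=.
by rewrite mevalC.
Qed.

Lemma tofr_Uprod_neq0 g : g.[0] != 0 -> tofr (Uprod n g) != 0.
Proof. by move=> g0; rewrite /tofr tofrac_eq0 Uprod_neq0. Qed.

Lemma horner0M_neq0 g g' : g.[0] != 0 -> g'.[0] != 0 -> (g * g').[0] != 0.
Proof. by move=> g0 g'0; rewrite hornerM mulf_neq0. Qed.

(** Algebraic independence of the [s_i]: identities between polynomials in them can be checked in
    [k[t]] and pulled back to free variables. *)
Lemma esym_inj q q' : esymp q = esymp q' -> q = q'.
Proof. exact: msym_fundamental_un. Qed.

Lemma HnP x : Hn x <->
  exists q g, g.[0] != 0 /\ x = tofr (esymp q) / tofr (Uprod n g).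
Proof.
split=> [[p [u [[q ->] [[g [g0 ->]] ->]]]]|[q [g [g0 ->]]]].
  by exists q, g.
by exists (esymp q), (Uprod n g); split; [exists q|split; [exists g|]].
Qed.

Lemma Hn_esym q : Hn (tofr (esymp q)).
Proof.
apply/HnP; exists q, 1; rewrite hornerC oner_neq0; split=> //.
by rewrite Uprod1 /tofr tofrac1 divr1.
Qed.

Lemma Hn_inv_Uprod g : g.[0] != 0 -> Hn (tofr (Uprod n g))^-1.
Proof.
move=> g0; apply/HnP; exists 1, g; split=> //.
by rewrite comp_mpoly1 /tofr tofrac1 mul1r.
Qed.

Lemma esymM q q' : esymp (q * q') = esymp q * esymp q'.
Proof. exact: rmorphM. Qed.

Lemma tofr_esymM q q' :
  tofr (esymp (q * q')) = tofr (esymp q) * tofr (esymp q').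
Proof. by rewrite esymM /tofr tofracM. Qed.

Lemma tofr_esymD q q' :
  tofr (esymp (q + q')) = tofr (esymp q) + tofr (esymp q').
Proof. by rewrite rmorphD /tofr tofracD. Qed.

Section Hom.
Variables (A : comAlgType k) (psi : Frac_t k n -> A).
Hypothesis hom_psi : is_Hn_hom psi.

(** The homomorphism from [k[s_1, .., s_n]], taken as a free polynomial ring, that sends [s_i] to
    [a i]; variables are numbered from [0], whence the shift. *)
Definition ev_esym (a : nat -> A) : {rmorphism {mpoly k[n]} -> A} :=
  mmap (in_alg A) (fun i : 'I_n => a i.+1).

Let a i := psi (tofr (mesym n k i)).

(** [psi] respects the operations only on [H_n], so it is not a ring morphism on its whole domain;
    its agreement with [ev_esym a] is proved by induction on [q]. *)
Lemma psi_esym q : psi (tofr (esymp q)) = ev_esym a q.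
Proof.
have [psi1 psiD psiM psiZ] := hom_psi.
pose f q := psi (tofr (esymp q)); rewrite -/(f q).
have f1 : f 1 = 1 by rewrite /f comp_mpoly1 /tofr tofrac1.
have fD : {morph f : x y / x + y}.
  by move=> x y; rewrite /f tofr_esymD psiD //; apply: Hn_esym.
have fM : {morph f : x y / x * y}.
  by move=> x y; rewrite /f tofr_esymM psiM //; apply: Hn_esym.
have fZ c x : f (c *: x) = c *: f x.
  rewrite -mul_mpolyC /f tofr_esymM comp_mpolyC psiZ //; exact: Hn_esym.
elim/mpolyind: q => [|c m q _ _ IHq].
  by rewrite rmorph0 -(scale0r (1 : {mpoly k[n]})) fZ scale0r.
rewrite fD IHq rmorphD; congr (_ + _).
rewrite fZ /= mmapZ mmapX /= mulr_algl; congr (_ *: _).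
rewrite mpolyXE_id (big_morph f fM f1); apply: eq_bigr => i _.
have fX x l : f (x ^+ l) = f x ^+ l.
  by elim: l => // l IHl; rewrite !exprS fM IHl.
by rewrite fX /f comp_mpolyXU -tnth_nth tnth_mktuple.
Qed.

Lemma FpolyE : Fpoly psi = map_poly (ev_esym a) (gen_poly k n).
Proof.
rewrite map_alt_poly; apply: (@eq_alt_poly _ _ a) => i le_in.
by rewrite /= -psi_esym comp_gen_esym.
Qed.

Lemma psi_mesym0 : a 0%N = 1.
Proof. by have [psi1 _ _ _] := hom_psi; rewrite /a mesym0E /tofr tofrac1. Qed.

Lemma monic_Fpoly : Fpoly psi \is monic.
Proof. exact: monic_alt_poly psi_mesym0. Qed.

Lemma size_Fpoly : size (Fpoly psi) = n.+1.
Proof. exact: size_alt_poly psi_mesym0. Qed.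

End Hom.

Lemma ev_gen_norm (A : comAlgType k) (a : nat -> A) g :
  ev_esym a (gen_norm n g)
  = mod_norm n (map_poly (ev_esym a) (gen_poly k n)) (map_poly (in_alg A) g).
Proof.
rewrite gen_norm.unlock (map_mod_norm _ _ (monic_gen_poly k n) (size_gen_poly k n)).
congr (mod_norm _ _ _); rewrite -map_poly_comp; apply: eq_map_poly => c.
exact: mmapC.
Qed.

(** The norm of [g] modulo [Fpoly psi] is [psi] of [Uprod n g], whose inverse is the value of [psi]
    at the inverse of [Uprod n g]. *)
Lemma Fpoly_invertible (A : comAlgType k) (psi : Frac_t k n -> A) :
  (0 < n)%N -> is_Hn_hom psi -> Sx_invertible_mod (Fpoly psi).
Proof.
move=> n0 hom_psi g g0; have [psi1 _ psiM _] := hom_psi.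
apply: (mod_norm_invertible (monic_Fpoly hom_psi) (size_Fpoly hom_psi) n0
          (c := psi (tofr (Uprod n g))^-1)).
rewrite {1}(FpolyE hom_psi) -ev_gen_norm -(psi_esym hom_psi) comp_gen_norm.
rewrite -psiM ?mulVf ?tofr_Uprod_neq0 //; first exact: Hn_inv_Uprod.
by rewrite -comp_gen_norm; apply: Hn_esym.
Qed.

(** The coefficients of [F] fix the values on the [s_i], hence on [k[s]]; the values on fractions
    follow because [Uprod n g] goes to a unit. *)
Lemma Hn_hom_ext (A : comAlgType k) (psi1 psi2 : Frac_t k n -> A) :
  is_Hn_hom psi1 -> is_Hn_hom psi2 -> Fpoly psi1 = Fpoly psi2 ->
  forall x, Hn x -> psi1 x = psi2 x.
Proof.
move=> hom1 hom2 eqF x Hx.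
have eqa := @alt_poly_inj _ n (fun i => psi1 (tofr (mesym n k i)))
  (fun i => psi2 (tofr (mesym n k i))) eqF.
have eqks q : psi1 (tofr (esymp q)) = psi2 (tofr (esymp q)).
  rewrite !psi_esym //; apply: eq_bigr => m _ /=; congr (_ * _).
  by apply: mmap1_eq => i; rewrite eqa.
have /HnP[q [g [g0 xE]]] := Hx; have Ug := tofr_Uprod_neq0 g0.
have HU : Hn (tofr (Uprod n g)) by rewrite -comp_gen_norm; apply: Hn_esym.
have HV := Hn_inv_Uprod g0.
have [psi11 _ psi1M _] := hom1; have [psi21 _ psi2M _] := hom2.
have e1 : psi1 x * psi1 (tofr (Uprod n g)) = psi1 (tofr (esymp q)).
  by rewrite -psi1M // xE divfK.
have e2 : psi2 x * psi2 (tofr (Uprod n g)) = psi2 (tofr (esymp q)).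
  by rewrite -psi2M // xE divfK.
have eU : psi1 (tofr (Uprod n g)) = psi2 (tofr (Uprod n g)).
  by rewrite -comp_gen_norm eqks.
have eV : psi2 (tofr (Uprod n g)) * psi2 (tofr (Uprod n g))^-1 = 1.
  by rewrite -psi2M // mulfV.
by rewrite -[LHS]mulr1 -[RHS]mulr1 -eV !mulrA -{1}eU e1 e2 eqks.
Qed.

(** * Construction of a homomorphism on [H_n] from a monic polynomial *)

Section Construct.
Variables (A : comAlgType k) (F : {poly A}).
Hypotheses (monF : F \is monic) (sizeF : size F = n.+1).
Hypothesis invF : Sx_invertible_mod F.

Let a i := (-1) ^+ i * F`_(n - i).
Let ev := ev_esym a.
Let N g := ev (gen_norm n g).

Lemma map_gen_poly : map_poly ev (gen_poly k n) = F.
Proof.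
rewrite -[RHS](alt_poly_coefs (n := n)) ?sizeF // map_alt_poly.
apply: eq_alt_poly => -[_|i lt_in] /=.
  by rewrite rmorph1 expr0 mul1r subn0 -(monicP monF) lead_coefE sizeF.
by have := gen_esymS k (Ordinal lt_in) => /= ->; rewrite mmapX mmap1U.
Qed.

Lemma ev_gen_norm_unit g : g.[0] != 0 -> exists c, c * N g = 1.
Proof.
move=> /invF[h [q /(mod_norm_unitl monF sizeF) e]]; exists (mod_norm n F h).
by rewrite /N ev_gen_norm map_gen_poly.
Qed.

Lemma ev_gen_normM g g' : N (g * g') = N g * N g'.
Proof.
rewrite /N -rmorphM; congr (ev _); apply: esym_inj.
by rewrite esymM !comp_gen_norm UprodM.
Qed.

(** The graph of the extension of [ev] to fractions; multiplying by [N g] avoids choosing an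
    inverse. *)
Definition frac_val (x : Frac_t k n) (y : A) :=
  exists q g, [/\ g.[0] != 0, x = tofr (esymp q) / tofr (Uprod n g)
                & y * N g = ev q].

(** Equality of fractions is cross-multiplied in [k[t]], pulled back by [esym_inj] and evaluated;
    then the unit [N (g * g')] is cancelled. *)
Lemma frac_val_unique x y y' : frac_val x y -> frac_val x y' -> y = y'.
Proof.
move=> [q [g [g0 -> yN]]] [q' [g' [g'0 /eqP xE y'N]]].
have e : q * gen_norm n g' = q' * gen_norm n g.
  apply: esym_inj; rewrite !esymM !comp_gen_norm; apply/eqP.
  have Ug := tofr_Uprod_neq0 g0; have Ug' := tofr_Uprod_neq0 g'0.
  by move: xE; rewrite (eqr_div _ _ Ug Ug') -!tofracM tofrac_eq.
have [c cN] := ev_gen_norm_unit (horner0M_neq0 g0 g'0).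
have {e} : y * N (g * g') = y' * N (g * g').
  rewrite ev_gen_normM mulrA yN [N g * _]mulrC mulrA y'N -!rmorphM.
  exact: congr1.
by move/(congr1 ( *%R^~ c)); rewrite -!mulrA ![N _ * c]mulrC cN !mulr1.
Qed.

Lemma frac_val_ex x : Hn x -> exists y, frac_val x y.
Proof.
case/HnP=> q [g [g0 ->]]; have [c cN] := ev_gen_norm_unit g0.
by exists (ev q * c), q, g; rewrite -mulrA cN mulr1.
Qed.

Lemma frac_val_esym q : frac_val (tofr (esymp q)) (ev q).
Proof.
exists q, 1; rewrite hornerC oner_neq0; split=> //.
  by rewrite Uprod1 /tofr tofrac1 divr1.
have -> : N 1 = ev 1; last by rewrite rmorph1 mulr1.
by congr (ev _); apply: esym_inj; rewrite comp_gen_norm Uprod1 comp_mpoly1.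
Qed.

Lemma frac_valM x x' y y' : frac_val x y -> frac_val x' y' ->
  frac_val (x * x') (y * y').
Proof.
move=> [q [g [g0 -> yN]]] [q' [g' [g'0 -> y'N]]].
exists (q * q'), (g * g'); rewrite horner0M_neq0 //; split=> //.
  by rewrite UprodM mulf_div -tofr_esymM /tofr tofracM.
by rewrite ev_gen_normM mulrACA yN y'N rmorphM.
Qed.

Lemma frac_valD x x' y y' : frac_val x y -> frac_val x' y' ->
  frac_val (x + x') (y + y').
Proof.
move=> [q [g [g0 -> yN]]] [q' [g' [g'0 -> y'N]]].
exists (q * gen_norm n g' + q' * gen_norm n g), (g * g').
rewrite horner0M_neq0 //; split=> //.
  rewrite addf_div ?tofr_Uprod_neq0 // tofr_esymD !tofr_esymM !comp_gen_norm.
  by rewrite UprodM /tofr tofracM.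
by rewrite ev_gen_normM rmorphD !rmorphM -yN -y'N -/(N g) -/(N g'); ring.
Qed.

Lemma exists_Hn_hom : exists psi : Frac_t k n -> A,
  is_Hn_hom psi /\ Fpoly psi = F.
Proof.
(* Outside [H_n] no value satisfies [frac_val x], and [psi x] is arbitrary there. *)
pose psi x := epsilon (inhabits (0 : A)) (frac_val x).
have psiP x : Hn x -> frac_val x (psi x).
  by move=> /frac_val_ex; apply: epsilon_spec.
have psiE x y : frac_val x y -> psi x = y.
  move=> xy; apply: frac_val_unique (xy).
  by apply: epsilon_spec; exists y.
have psiC c : frac_val (tofr c%:MP) c%:A.
  by have := frac_val_esym c%:MP; rewrite comp_mpolyC /ev /= mmapC.
exists psi; split; last first.
  rewrite -[RHS](alt_poly_coefs (n := n)) ?sizeF //.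
  apply: (@eq_alt_poly _ _ (fun i => psi (tofr (mesym n k i)))) => i le_in.
  rewrite -comp_gen_esym // (psiE _ _ (frac_val_esym _)).
  have := map_gen_poly; rewrite map_alt_poly.
  rewrite -[in RHS](alt_poly_coefs (n := n) (F := F)) ?sizeF //.
  by move/alt_poly_inj => /(_ i le_in).
split=> [|x y /psiP xP /psiP yP|x y /psiP xP /psiP yP|c x /psiP xP];
  apply: psiE.
- by have := psiC 1; rewrite scale1r mpolyC1 /tofr tofrac1.
- exact: frac_valD.
- exact: frac_valM.
- by rewrite -mulr_algl; apply: frac_valM.
Qed.

End Construct.
End HnRing.

(** * From a free quotient of rank [n] to a monic generator *)

Section Hilb.
Variables (k : fieldType) (n : nat) (A : comAlgType k) (L : comPzRingType).
Variables (j : {rmorphism {poly A} -> L}) (I : L -> Prop) (e : 'I_n -> L).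
Hypotheses (locj : is_localization (@Sx k A) j) (idI : is_ideal I).
Hypothesis basis_e : forall l : L,
  exists! a : {ffun 'I_n -> A}, I (l - \sum_(i < n) j ((a i)%:P) * e i).
Implicit Types (c : 'rV[A]_n) (M : 'M[A]_n) (l v : L) (p r : {poly A}).

Let lin c := \sum_(i < n) j (c 0 i)%:P * e i.

Lemma idealD x y : I x -> I y -> I (x + y).
Proof. by case: idI => _ ID _; apply: ID. Qed.

Lemma idealM l x : I x -> I (l * x).
Proof. by case: idI => _ _; apply. Qed.

Lemma idealN x : I x -> I (- x).
Proof. by rewrite -mulN1r; apply: idealM. Qed.

Lemma ideal_sum (T : finType) (f : T -> L) :
  (forall i, I (f i)) -> I (\sum_i f i).
Proof. by move=> If; apply: big_ind => //; [case: idI | apply: idealD]. Qed.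

Lemma ideal_trans y x z : I (x - y) -> I (y - z) -> I (x - z).
Proof. by move=> xy yz; rewrite -(subrKA y); apply: idealD. Qed.

Lemma ideal_sym x y : I (x - y) -> I (y - x).
Proof. by move/idealN; rewrite opprB. Qed.

Lemma ideal_congrM l x y : I (x - y) -> I (l * x - l * y).
Proof. by rewrite -mulrBr; apply: idealM. Qed.

Lemma coord_ex l : exists c, I (l - lin c).
Proof.
have [a [Ia _]] := basis_e l; exists (\row_i a i).
by move: Ia; congr (I (_ - _)); apply: eq_bigr => i _; rewrite mxE.
Qed.

Lemma coord_uniq c c' : I (lin c - lin c') -> c = c'.
Proof.
move=> Icc'; have [a [_ a_uniq]] := basis_e (lin c).
have rowE c0 : I (lin c - lin c0) -> a = [ffun i => c0 0 i].
  move=> Ic0; apply: a_uniq; move: Ic0; congr (I (_ - _)).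
  by apply: eq_bigr => i _; rewrite ffunE.
have := rowE _ Icc'; rewrite (rowE c); last by rewrite subrr; case: idI.
by move/ffunP=> ecc'; apply/rowP => i; have := ecc' i; rewrite !ffunE.
Qed.

Lemma lin_mulmx c M : lin (c *m M) = \sum_i j (c 0 i)%:P * lin (row i M).
Proof.
under [RHS]eq_bigr do rewrite mulr_sumr.
rewrite exchange_big; apply: eq_bigr => i _ /=.
rewrite mxE rmorph_sum rmorph_sum mulr_suml; apply: eq_bigr => m _ /=.
by rewrite mxE polyCM rmorphM mulrA.
Qed.

Lemma lin_delta i : lin (delta_mx 0 i) = e i.
Proof.
rewrite /lin (bigD1 i) //= mxE !eqxx rmorph1 mul1r big1 ?addr0 // => m mi.
by rewrite mxE eqxx (negPf mi) /= rmorph0 mul0r.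
Qed.

Definition is_mul_mx l M := forall i, I (l * e i - lin (row i M)).

Lemma mul_mx_ex l : exists M, is_mul_mx l M.
Proof.
have [c Ic] := fin_all_exists (fun i => coord_ex (l * e i)).
by exists (\matrix_i c i) => i; rewrite rowK.
Qed.

Lemma mul_mx_lin l M c : is_mul_mx l M -> I (l * lin c - lin (c *m M)).
Proof.
move=> lM; rewrite lin_mulmx mulr_sumr -sumrB; apply: ideal_sum => i.
by rewrite mulrCA; apply/ideal_congrM/lM.
Qed.

Lemma mul_mx_inv l v M M' : l * v = 1 -> is_mul_mx l M -> is_mul_mx v M' ->
  M *m M' = 1%:M.
Proof.
move=> lv lM vM'; apply/row_matrixP => i; rewrite row_mul row1.
apply: coord_uniq; rewrite lin_delta; apply: ideal_sym.
rewrite -[e i]mul1r -lv [l * v]mulrC -mulrA.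
by apply: ideal_trans (mul_mx_lin _ vM'); apply/ideal_congrM/lM.
Qed.

(* Cayley-Hamilton, by the adjugate trick. *)
Lemma char_poly_in_ideal p M : is_mul_mx (j p) M -> I (j (char_poly M \Po p)).
Proof.
move=> pM; pose B := map_mx (comp_poly p) (char_poly_mx M).
have BE i m : B i m = p *+ (i == m) - (M i m)%:P.
  by rewrite !mxE rmorphB rmorphMn /= comp_polyX comp_polyC.
have detB : char_poly M \Po p = \det B by rewrite det_map_mx.
have IB i : I (\sum_m j (B i m) * e m).
  move: (pM i); congr I; rewrite /lin.
  under [RHS]eq_bigr do rewrite BE rmorphB rmorphMn mulrBl mulrnAl mulrb.
  rewrite sumrB -big_mkcond (big_pred1 i) => [|m]; last by rewrite eq_sym.
  congr (_ - _).
  by apply: eq_bigr => m _; rewrite mxE.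
have IBe i : I (j (\det B) * e i).
  have -> : j (\det B) * e i = \sum_m j ((\adj B *m B) i m) * e m.
    rewrite mul_adj_mx (bigD1 i) //= !mxE eqxx mulr1n big1 ?addr0 // => m mi.
    by rewrite mxE eq_sym (negPf mi) mulr0n rmorph0 mul0r.
  have -> : \sum_m j ((\adj B *m B) i m) * e m
          = \sum_s j (\adj B i s) * \sum_m j (B s m) * e m.
    under [RHS]eq_bigr do rewrite mulr_sumr.
    rewrite [RHS]exchange_big; apply: eq_bigr => m _ /=.
    rewrite mxE rmorph_sum mulr_suml; apply: eq_bigr => s _ /=.
    by rewrite rmorphM mulrA.
  by apply: ideal_sum => s; apply: idealM.
rewrite detB; have [c Ic] := coord_ex 1.
rewrite -[j _]subr0; apply: (@ideal_trans (j (\det B) * lin c)).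
  by rewrite -{1}[j _]mulr1; apply: ideal_congrM.
rewrite subr0 mulr_sumr; apply: ideal_sum => i; rewrite mulrCA.
exact: idealM.
Qed.

(* The constant term of the characteristic polynomial of [p] is a unit, so
   Cayley-Hamilton can be solved for [v]. *)
Lemma inv_congr_poly p v : j p * v = 1 -> exists w, I (v - j w).
Proof.
move=> pv; have [M pM] := mul_mx_ex (j p); have [M' vM'] := mul_mx_ex v.
have detM : \det M * \det M' = 1.
  by rewrite -det_mulmx (mul_mx_inv pv pM vM') det1.
have := char_poly_in_ideal pM; have := char_poly_det M.
elim/poly_ind: (char_poly M) => [|q b _].
  rewrite coef0 => e0; exists 0; rewrite rmorph0 subr0.
  suff v0 : v = 0 by rewrite v0; case: idI.
  have d0 : \det M = 0 by rewrite -[\det M](signrMK n) -e0 mulr0.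
  rewrite -[v]mulr1 -(rmorph1 j) -(rmorph1 (@polyC A)) -detM d0 mul0r.
  by rewrite !rmorph0 mulr0.
rewrite coefD coefMX coefC eqxx add0r => bE.
rewrite comp_polyD comp_polyM comp_polyX comp_polyC => Iq.
(* With characteristic polynomial [q * 'X + b], Cayley-Hamilton gives [(q \Po p) * p + b] in the
   ideal, and [b] has inverse [(-1) ^+ n * \det M']. Multiplying by this inverse and by [v] isolates
   [v]. *)
exists (- ((-1) ^+ n * \det M')%:P * (q \Po p)).
have := idealM (j ((-1) ^+ n * \det M')%:P * v) Iq; congr I.
have bd : j b%:P * j ((-1) ^+ n * \det M')%:P = 1.
  rewrite -rmorphM -polyCM bE mulrACA -expr2 sqrr_sign mul1r detM.
  by rewrite polyC1 rmorph1.
move: ((-1) ^+ n * \det M')%:P bd => d0 bd.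
rewrite rmorphD !rmorphM rmorphN; set d := j d0 in bd *; set Q := j (q \Po p).
transitivity (d * Q * (j p * v) + (j b%:P * d) * v); first by ring.
by rewrite pv bd; ring.
Qed.

(** Surjectivity of [A[x] -> L/I]: a fraction is a polynomial times the inverse of a denominator,
    itself congruent to a polynomial. *)
Lemma congr_poly l : exists w, I (l - j w).
Proof.
have [loc1 loc2 _] := locj; have [r [s [Ss lr]]] := loc2 l.
have [v sv] := loc1 s Ss; have [w vw] := inv_congr_poly sv.
exists (r * w); rewrite rmorphM -lr -[l in I (l - _)]mulr1 -sv.
by rewrite mulrA; apply: ideal_congrM.
Qed.

Lemma Hilb_monic : exists F : {poly A},
  [/\ F \is monic, size F = n.+1, I (j F) &
      forall r, (size r <= n)%N -> I (j r) -> r = 0].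
Proof.
have [MX XM] := mul_mx_ex (j 'X); set F := char_poly MX.
have monF : F \is monic := char_poly_monic MX.
have sF : size F = n.+1 := size_char_poly MX.
have IF : I (j F) by have := char_poly_in_ideal XM; rewrite comp_polyXr.
exists F; split=> // r sr Ir.
(* [Q] will express the basis [e] in the powers of [x], and [P] the powers of [x] in the basis
   [e]. *)
have small_ex i : exists c : 'rV[A]_n, I (e i - j (rVpoly c)).
  have [w Iw] := congr_poly (e i); exists (poly_rV (rmodp w F)).
  rewrite (poly_rV_rmodpK monF sF); apply: ideal_trans Iw _.
  rewrite {1}(rdivp_eq monF w) rmorphD addrK rmorphM; exact: idealM.
have [q Iq] := fin_all_exists small_ex; pose Q := \matrix_i q i.
have [x Ix] := fin_all_exists (fun i : 'I_n => coord_ex (j 'X^i)).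
pose P := \matrix_i x i.
have IP c : I (j (rVpoly c) - lin (c *m P)).
  rewrite lin_mulmx rVpolyE rmorph_sum -sumrB; apply: ideal_sum => i /=.
  by rewrite -mul_polyC rmorphM rowK; apply: ideal_congrM.
have QP : Q *m P = 1%:M.
  apply/row_matrixP => i; rewrite row_mul row1; apply: coord_uniq.
  rewrite lin_delta rowK; apply: ideal_sym; exact: ideal_trans (IP _).
have r0 : (poly_rV r : 'rV_n) *m P = 0.
  have lin0 : lin 0 = 0.
    by rewrite /lin big1 // => i _; rewrite mxE polyC0 rmorph0 mul0r.
  apply: coord_uniq; rewrite lin0; apply: ideal_trans (ideal_sym (IP _)) _.
  by rewrite poly_rV_K // subr0.
(* Here the rank counts: [P] and [Q] are square, so [QP = 1] gives [PQ = 1], and [P] kills no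
   nonzero row vector. *)
rewrite -(poly_rV_K sr) -[poly_rV r]mulmx1 -(mulmx1C QP) mulmxA r0 mul0mx.
exact: linear0.
Qed.

End Hilb.

Lemma in_Hilb_principal (k : fieldType) n (A : comAlgType k)
    (L : comPzRingType) (j : {rmorphism {poly A} -> L}) (I : L -> Prop) :
  is_localization (@Sx k A) j -> in_Hilb j n I ->
  exists F : {poly A}, [/\ F \is monic, size F = n.+1, Sx_invertible_mod F
    & I = pideal (j F)].
Proof.
move=> locj [idI [e He]]; have [F [monF sF IF small]] := Hilb_monic locj idI He.
have [loc1 loc2 _] := locj; have [_ ID IM] := idI.
(* The remainder of [r] modulo [F] stays in the ideal and is small, hence zero. *)
have dvdF r : I (j r) -> exists q, r = q * F.
  move=> Ir; exists (rdivp r F); rewrite {1}(rdivp_eq monF r).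
  rewrite (small (rmodp r F)) ?addr0 ?size_rmodp_monic //.
  have -> : rmodp r F = r + (- rdivp r F) * F.
    by rewrite {2}(rdivp_eq monF r); ring.
  by rewrite rmorphD rmorphM; apply: ID => //; apply: IM.
exists F; split=> //.
  move=> g g0; have [|v gv] := loc1 (map_poly (in_alg A) g); first by exists g.
  (* The inverse [v] of [g] in [L] is congruent to a polynomial [w]; then [w * g - 1] lies in the
     ideal, so [F] divides it. *)
  have [w Iw] := inv_congr_poly idI He gv; exists w.
  have [|q qE] := dvdF (w * map_poly (in_alg A) g - 1).
    have := IM (- j (map_poly (in_alg A) g)) _ Iw; congr I.
    by rewrite rmorphB rmorphM rmorph1 -gv; ring.
  by exists q; rewrite -qE addrC subrK.
apply: functional_extensionality => y; apply: propositional_extensionality.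
split=> [Iy|[l ->]]; last exact: IM.
have [r [s [Ss yr]]] := loc2 y; have [v sv] := loc1 s Ss.
have [|q qE] := dvdF r; first by rewrite -yr mulrC; apply: IM.
exists (v * j q); rewrite -mulrA -rmorphM -qE -yr mulrCA [v * _]mulrC.
by rewrite sv mulr1.
Qed.

(** * Uniqueness of the monic generator, base change and the bijection *)

Lemma size_monic_sub (R : nzRingType) n (F G : {poly R}) :
  F \is monic -> G \is monic -> size F = n.+1 -> size G = n.+1 ->
  (size (F - G)%R <= n)%N.
Proof.
rewrite !monicE !lead_coefE => /eqP monF /eqP monG sF sG.
move: monF monG; rewrite sF sG /= => F1 G1.
apply/leq_sizeP => m; rewrite leq_eqVlt coefB => /orP[/eqP<-|lt_nm].
  by rewrite F1 G1 subrr.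
by rewrite !nth_default ?sF ?sG ?subrr.
Qed.

Lemma map_Fpoly (k : fieldType) n (A B : comAlgType k)
    (phi : {lrmorphism A -> B}) (psi : Frac_t k n -> A) :
  map_poly phi (Fpoly psi) = Fpoly (phi \o psi).
Proof. exact: (map_alt_poly phi n (fun i => psi (tofr (mesym n k i)))). Qed.

Lemma ext_pideal (L1 L2 : comPzRingType) (Phi : {rmorphism L1 -> L2}) (f : L1) :
  ext_ideal Phi (pideal f) = pideal (Phi f).
Proof.
apply: functional_extensionality => y; apply: propositional_extensionality.
split=> [[m [l [x [Ix ->]]]]|[l ->]].
  have [I0 ID IM] := pideal_is_ideal (Phi f).
  apply: big_ind => // i _; apply: IM.
  by have [z ->] := Ix i; exists (Phi z); rewrite rmorphM.
exists 1%N, (fun=> l), (fun=> f); rewrite big_ord1; split=> // _.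
by exists 1; rewrite mul1r.
Qed.
Unset Implicit Arguments.
Theorem theorem4p4 (k : fieldType) (n : nat) (hn : (1 <= n)%N) :
  (* for every k-algebra A, with L = A (x)_k k[x]_(x) presented as the
     localization j : A[x] -> L at {g(x) : g(0) <> 0}, F(A) is a bijection
     Hom_{k-alg}(H_n, A) -> Hilb_a^n(A) *)
  (forall (A : comAlgType k) (L : comPzRingType) (j : {rmorphism {poly A} -> L}),
     is_localization (@Sx k A) j ->
     [/\ (forall psi : Frac_t k n -> A, is_Hn_hom psi ->
            in_Hilb j n (pideal (j (Fpoly psi)))),
         (forall psi1 psi2 : Frac_t k n -> A, is_Hn_hom psi1 -> is_Hn_hom psi2 ->
            pideal (j (Fpoly psi1)) = pideal (j (Fpoly psi2)) ->
            forall x, Hn x -> psi1 x = psi2 x) &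
         (forall I : L -> Prop, in_Hilb j n I ->
            exists psi : Frac_t k n -> A, is_Hn_hom psi /\
              I = pideal (j (Fpoly psi)))]) /\
  (* naturality in A *)
  (forall (A B : comAlgType k) (phi : {lrmorphism A -> B})
          (LA LB : comPzRingType) (jA : {rmorphism {poly A} -> LA})
          (jB : {rmorphism {poly B} -> LB}) (Phi : {rmorphism LA -> LB}),
     is_localization (@Sx k A) jA -> is_localization (@Sx k B) jB ->
     (forall p : {poly A}, Phi (jA p) = jB (map_poly phi p)) ->
     forall psi : Frac_t k n -> A, is_Hn_hom psi ->
       ext_ideal Phi (pideal (jA (Fpoly psi))) =
       pideal (jB (Fpoly (phi \o psi)))).
Proof.
split=> [A L j locj|A B phi LA LB jA jB Phi _ _ PhiE psi _]; last first.
  by rewrite ext_pideal PhiE map_Fpoly.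
split=> [psi hom|psi1 psi2 hom1 hom2 eqI|I HI].
- apply: in_Hilb_pideal (monic_Fpoly hom) (size_Fpoly hom) _ => //.
  exact: Fpoly_invertible.
(* Equal ideals force equal polynomials: the difference of the two monic polynomials has size at
   most [n] and lies in the second ideal. *)
- apply: Hn_hom_ext => //; apply/eqP; rewrite -subr_eq0; apply/eqP.
  apply: (pideal_small_eq0 locj (monic_Fpoly hom2) (size_Fpoly hom2)).
  + exact: Fpoly_invertible.
  + by apply: size_monic_sub; rewrite ?monic_Fpoly ?size_Fpoly.
  rewrite rmorphB; have [_ ID IM] := pideal_is_ideal (j (Fpoly psi2)).
  apply: ID; first by rewrite -eqI; exists 1; rewrite mul1r.
  by exists (-1); rewrite mulN1r.
have [F [monF sF invF ->]] := in_Hilb_principal locj HI.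
have [psi [hom psiF]] := exists_Hn_hom monF sF invF.
by exists psi; rewrite psiF.
Qed.
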